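(* Let $n\in\mathbb{N}$, $y_1,\dots,y_n\in\{-1,+1\}$, let $K\in\mathbb{R}^{n\times n}$ be a symmetric strictly positive definite matrix with columns $K_1,\dots,K_n$, and let $\ell:\mathbb{R}\to\mathbb{R}$ be convex and twice continuously differentiable. For $c\in\mathbb{R}^n_{\ge0}$ let $(\alpha^\star,b^\star)$ be a solution of $$\min_{\alpha\in\mathbb{R}^n,\,b\in\mathbb{R}}\ \tfrac12\alpha^\top K\alpha+\sum_{i=1}^nc_i\,\ell\big(y_i[K_i^\top\alpha+b]\big),$$ and define $u_i=y_i\,\ell'(y_i[K_i^\top\alpha^\star+b^\star])$ and $v_i=c_i\,\ell''(y_i[K_i^\top\alpha^\star+b^\star])$, $i=1,\dots,n$. If $v\neq0$, then the solution is unique, $\alpha^\star$ and $b^\star$ are continuously differentiable functions of $c$, and $$\begin{bmatrix}\partial\alpha^\star/\partial c\\ \partial b^\star/\partial c\end{bmatrix}=-\begin{bmatrix}I+\operatorname{diag}(v)K & v\\ \mathbf 1^\top & 0\end{bmatrix}^{-1}\begin{bmatrix}\operatorname{diag}(u)\\ 0^\top\end{bmatrix}.$$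
   Context: $\mathbf 1$ is the all-ones vector in $\mathbb{R}^n$, $I$ the $n\times n$ identity, $\partial\alpha^\star/\partial c$ the $n\times n$ Jacobian and $\partial b^\star/\partial c$ the $1\times n$ row of partial derivatives. *)

(* Defs.v *)
From HB Require Import structures.
From mathcomp Require Import all_boot all_order all_algebra.
From mathcomp Require Import all_classical all_reals all_analysis.
Set Implicit Arguments. Unset Strict Implicit. Unset Printing Implicit Defensive.
Import Order.TTheory GRing.Theory Num.Theory.
Import numFieldNormedType.Exports.
Local Open Scope ring_scope.
Local Open Scope classical_set_scope.

(* Vectors in R^n are row vectors 'rV[R]_n (the convention of MathComp-Analysis,
   whose Jacobian 'J f p satisfies 'd f p h = h *m 'J f p, i.e. 'J f p is the
   TRANSPOSE of the usual Jacobian matrix). *)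

Definition convex_fun (R : realType) (l : R -> R) :=
  forall x y t : R, 0 <= t -> t <= 1 ->
    l (t * x + (1 - t) * y) <= t * l x + (1 - t) * l y.

Definition C2 (R : realType) (l : R -> R) :=
  (forall x, derivable l x 1) /\ (forall x, derivable (derive1 l) x 1) /\
  continuous (derive1 (derive1 l)).

Definition margin (R : realType) n (K : 'M[R]_n) (a : 'rV[R]_n) (b : R) (i : 'I_n) : R :=
  \sum_(j < n) K j i * a ord0 j + b.

Definition objective (R : realType) n (K : 'M[R]_n) (y : 'I_n -> R) (l : R -> R)
  (c : 'rV[R]_n) (a : 'rV[R]_n) (b : R) : R :=
  2^-1 * (a *m K *m a^T) ord0 ord0 +
  \sum_(i < n) c ord0 i * l (y i * margin K a b i).

Definition is_solution (R : realType) n (K : 'M[R]_n) (y : 'I_n -> R) (l : R -> R)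
  (c : 'rV[R]_n) (a : 'rV[R]_n) (b : R) : Prop :=
  forall (a' : 'rV[R]_n) (b' : R), objective K y l c a b <= objective K y l c a' b'.

Definition kkt_matrix (R : realType) n (K : 'M[R]_n) (v : 'rV[R]_n) : 'M[R]_(n + 1) :=
  block_mx (1%:M + diag_mx v *m K) v^T (const_mx 1) (0 : 'M[R]_1).

(* Main.v *)
(** Since [K] is positive definite, convexity turns optimality into the square system
    [alpha + c . u(alpha, b) = 0], [1^T alpha = 0], whose Jacobian in [(alpha, b)] is the
    KKT matrix; it is invertible when [0 <= v != 0]. The system is affine in [c] and
    nonlinear only through the scalar function [l'], so its increments are exact
    matrix products: [G c' x' - G c x = (c' - c) L x + (x' - x) N c' x x'], where [N] is a
    KKT matrix filled with difference quotients of [l'] (controlled by the scalar mean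
    value theorem). The implicit function then comes from Banach's fixed point theorem
    for [x - G c x N0^-1], and solving the increment identity for [f c' - f c] exhibits
    it as [(c' - c)] times a matrix continuous in [c'], whose value at [c' = c] is the
    Jacobian. *)

Require Import Defs.
From HB Require Import structures.
From mathcomp Require Import all_boot all_order all_algebra.
From mathcomp Require Import all_classical all_reals all_analysis.
From mathcomp Require Import ring lra.
Import Order.TTheory GRing.Theory Num.Theory.
Import numFieldNormedType.Exports.
Local Open Scope ring_scope.
Local Open Scope classical_set_scope.
Set Implicit Arguments.
Unset Strict Implicit.
Unset Printing Implicit Defensive.

(* Makes ['M[R]_(m, n)] inherit the complete normed module structure. *)
HB.instance Definition _ (R : realType) m n := NormedModule.on 'M[R]_(m, n).

(** * Limits of matrix-valued functions *)

Section matrix_limits.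
Context {R : realType} {T : Type} {F : set_system T} {FF : Filter F}.

Lemma cvg_mx m n (f : T -> 'M[R]_(m, n)) (A : 'M[R]_(m, n)) :
  (forall i j, f x i j @[x --> F] --> A i j) -> f x @[x --> F] --> A.
Proof.
move=> fA; apply/cvg_ballP => e e0.
have : \forall x \near F, forall i j, ball (A i j) e (f x i j).
  apply: filter_forall => i; apply: filter_forall => j.
  by move/cvg_ballP: (fA i j) => /(_ e e0).
by apply: filterS => x fx; split.
Qed.

Lemma cvg_coord m n (f : T -> 'M[R]_(m, n)) (A : 'M[R]_(m, n)) i j :
  f x @[x --> F] --> A -> f x i j @[x --> F] --> A i j.
Proof. by move=> fA; exact: (cvg_comp _ _ fA (@coord_continuous _ _ _ i j A)). Qed.

Lemma cvg_bigsum (I : Type) (r : seq I) (P : pred I) (f : I -> T -> R) (a : I -> R) :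
  (forall i, P i -> f i x @[x --> F] --> a i) ->
  \sum_(i <- r | P i) f i x @[x --> F] --> \sum_(i <- r | P i) a i.
Proof. by apply: cvg_big; exact: add_continuous. Qed.

Lemma cvg_bigprod (I : Type) (r : seq I) (P : pred I) (f : I -> T -> R) (a : I -> R) :
  (forall i, P i -> f i x @[x --> F] --> a i) ->
  \prod_(i <- r | P i) f i x @[x --> F] --> \prod_(i <- r | P i) a i.
Proof. by apply: cvg_big; exact: mul_continuous. Qed.

Lemma cvg_mulmx m n p (f : T -> 'M[R]_(m, n)) (g : T -> 'M[R]_(n, p))
    (A : 'M[R]_(m, n)) (B : 'M[R]_(n, p)) :
  f x @[x --> F] --> A -> g x @[x --> F] --> B -> f x *m g x @[x --> F] --> A *m B.
Proof.
move=> fA gB; apply: cvg_mx => i j; rewrite mxE.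
under eq_cvg do rewrite mxE.
by apply: cvg_bigsum => k _; apply: cvgM; exact: cvg_coord.
Qed.

Lemma cvg_trmx m n (f : T -> 'M[R]_(m, n)) (A : 'M[R]_(m, n)) :
  f x @[x --> F] --> A -> (f x)^T @[x --> F] --> A^T.
Proof.
move=> fA; apply: cvg_mx => i j; rewrite mxE.
by under eq_cvg do rewrite mxE; exact: cvg_coord.
Qed.

Lemma cvg_diag_mx n (f : T -> 'rV[R]_n) (d : 'rV[R]_n) :
  f x @[x --> F] --> d -> diag_mx (f x) @[x --> F] --> diag_mx d.
Proof.
move=> fd; apply: cvg_mx => i j; rewrite mxE.
by under eq_cvg do rewrite mxE; apply: cvgMn; exact: cvg_coord.
Qed.

Lemma cvg_det n (f : T -> 'M[R]_n) (A : 'M[R]_n) :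
  f x @[x --> F] --> A -> \det (f x) @[x --> F] --> \det A.
Proof.
move=> fA; apply: cvg_bigsum => s _; apply: cvgMl_tmp; apply: cvg_bigprod => i _.
exact: cvg_coord.
Qed.

(** Close to an invertible limit the determinant stays nonzero, so there [invmx] is the adjugate
    divided by the determinant, whose entries converge. The formula holds only eventually: on
    singular matrices [invmx] takes a default value. *)
Lemma cvg_invmx n (f : T -> 'M[R]_n) (A : 'M[R]_n) : A \in unitmx ->
  f x @[x --> F] --> A -> invmx (f x) @[x --> F] --> invmx A.
Proof.
move=> uA fA; have detA : \det A != 0 by rewrite -unitfE -unitmxE.
rewrite {2}/invmx uA; apply: cvg_trans.
  apply: (@near_eq_cvg _ _ F _ (fun x => (\det (f x))^-1 *: \adj (f x))
    (fun x => invmx (f x))).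
  have : \forall x \near F, \det (f x) != 0.
    by apply: cvgr_neq0 detA; exact: cvg_det.
  by apply: filterS => x dx; rewrite /invmx unitmxE unitfE dx.
apply: cvg_mx => i j; rewrite !mxE.
under eq_cvg do rewrite !mxE.
apply: cvgM; first by apply: cvgV => //; exact: cvg_det.
apply: cvgMl_tmp; apply: cvg_det; apply: cvg_mx => k k'; rewrite !mxE.
by under eq_cvg do rewrite !mxE; exact: cvg_coord.
Qed.

End matrix_limits.

(** * Max-entry norm estimates, Banach's theorem on a closed set, and Jacobians from exact slopes *)

Lemma ler_mx_normP (R : realType) m n (A : 'M[R]_(m, n)) e : 0 <= e ->
  (forall i j, `|A i j| <= e) -> `|A| <= e.
Proof.
move=> e0 Ae; rewrite [leLHS]mx_normrE; apply/bigmax_leP; by split => //= ij _.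
Qed.

Lemma ler_coord_mx_norm (R : realType) m n (A : 'M[R]_(m, n)) i j : `|A i j| <= `|A|.
Proof.
by rewrite [leRHS]mx_normrE; apply/bigmax_geP; right; exists (i, j).
Qed.

(** The norm is the largest absolute entry, which is not submultiplicative: each entry of the
    product sums [n] terms, hence the factor [n]. *)
Lemma ler_mx_normM (R : realType) m n p (A : 'M[R]_(m, n)) (B : 'M[R]_(n, p)) :
  `|A *m B| <= n%:R * `|B| * `|A|.
Proof.
apply: ler_mx_normP => [|i j]; first by rewrite !mulr_ge0.
rewrite mxE (le_trans (ler_norm_sum _ _ _))//.
have -> : n%:R * `|B| * `|A| = \sum_(k < n) `|A| * `|B|.
  by rewrite sumr_const card_ord -mulrA mulr_natl mulrC.
by apply: ler_sum => k _; rewrite normrM ler_pM// ler_coord_mx_norm.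
Qed.

Lemma contraction_fixpoint (R : realType) (X : completeNormedModType R) (U : set X)
    (f : X -> X) (q : {nonneg R}) (x0 : X) : q%:num < 1 -> closed U -> U x0 ->
  (forall x, U x -> U (f x)) ->
  (forall x y, U x -> U y -> `|f x - f y| <= q%:num * `|x - y|) ->
  exists2 x, U x & x = f x.
Proof.
move=> q1 Ucl Ux0 fU flip.
have [] := @banach_fixed_point R X U (mkfun_fun fU); last by move=> x Ux fx; exists x.
- by exists q; split => // -[x y] [/= Ux Uy]; exact: flip.
- exact: Ucl.
- by exists x0.
Qed.

(** Carathéodory's form of differentiability: the error of the linear approximation is exactly
    [(z' - z) *m (S z' - S z)], which is of smaller order because [S] is continuous at [z]. *)
Lemma slope_jacobian (R : realType) n m (f : 'rV[R]_n -> 'rV[R]_m) (z : 'rV[R]_n)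
    (S : 'rV[R]_n -> 'M[R]_(n, m)) :
  (\forall z' \near z, f z' - f z = (z' - z) *m S z') -> {for z, continuous S} ->
  differentiable f z /\ 'J f z = S z.
Proof.
move=> fS cS.
have Dc : continuous (mulmxr (S z) : 'rV[R]_n -> 'rV[R]_m).
  by move=> h; exact: (@cvg_mulmx _ _ (nbhs h) _ _ _ _ id (fun=> S z) _ _ cvg_id (cvg_cst _)).
have Df : f \o shift z = cst (f z) + mulmxr (S z) +o_ 0 id.
  apply/eqaddoP => e e0.
  (* The division absorbs the factor [n] of the product bound; the [+ 1] keeps it legitimate when
     [n = 0]. *)
  pose d := e / (n%:R + 1).
  have n1 : 0 < n%:R + 1 :> R by rewrite ltr_wpDl.
  have d0 : 0 < d by rewrite divr_gt0.
  have : \forall z' \near z, f z' - f z = (z' - z) *m S z' /\ `|S z - S z'| <= d.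
    by apply: filterI => //; move/cvgrPdist_le: cS; apply.
  rewrite (near_shift 0) subr0; apply: filterS => h /= [fh Sh].
  rewrite !fctE /= opprD addrA fh addrK -mulmxBr.
  apply: (le_trans (ler_mx_normM h (S (h + z) - S z))).
  rewrite ler_wpM2r// distrC (le_trans (ler_wpM2l _ Sh))//.
  by rewrite /d mulrA ler_pdivrMr// (mulrC e) ler_pM2r// lerDl.
have dfE := diff_unique Dc Df.
split; last by apply/row_matrixP => i; rewrite !rowE mul_rV_lin1 dfE.
by apply/diff_locallyP; rewrite dfE.
Qed.

(** * An implicit function theorem *)

Lemma continuous_mulmxr (R : realType) n m p (A : 'M[R]_(m, p)) :
  continuous (fun B : 'M[R]_(n, m) => B *m A).
Proof.
by move=> B; exact: (@cvg_mulmx _ _ (nbhs B) _ _ _ _ id (fun=> A) _ _ cvg_id (cvg_cst _)).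
Qed.

(* [N (c, (x, x'))] plays the role of the partial Jacobian of [G c] averaged over the
   segment from [x] to [x']; it is only required to be continuous on the diagonal. *)
Section implicit_function.
Context {R : realType} {n m : nat}.
Variables (G : 'rV[R]_n -> 'rV[R]_m -> 'rV[R]_m).
Variables (N : 'rV[R]_n * ('rV[R]_m * 'rV[R]_m) -> 'M[R]_m).
Variables (L : 'rV[R]_m -> 'M[R]_(n, m)).
Hypothesis GE : forall c c' x x',
  G c' x' - G c x = (c' - c) *m L x + (x' - x) *m N (c', (x, x')).
Hypothesis N_continuous : forall c x, {for (c, (x, x)), continuous N}.
Hypothesis L_continuous : continuous L.
Variables (c0 : 'rV[R]_n) (x0 : 'rV[R]_m).
Hypothesis G0 : G c0 x0 = 0.
Hypothesis N0_unit : N (c0, (x0, x0)) \in unitmx.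

Let W := invmx (N (c0, (x0, x0))).

(** Near the base point [N *m W] is within one half of the identity. This single estimate yields the
    contraction, the Lipschitz bound on roots and the invertibility of [N]. *)
Let Wnear : exists2 r : R, 0 < r & forall c x x',
  `|c0 - c| < r -> `|x0 - x| <= r -> `|x0 - x'| <= r ->
  forall y : 'rV[R]_m, `|y - y *m N (c, (x, x')) *m W| <= 2^-1 * `|y|.
Proof.
pose e : R := 2^-1 / (m%:R + 1).
have m1 : 0 < m%:R + 1 :> R by rewrite ltr_wpDl.
have e0 : 0 < e by rewrite divr_gt0.
have NW : N p *m W @[p --> nbhs (c0, (x0, x0))] --> (1%:M : 'M[R]_m).
  rewrite -(mulmxV N0_unit).
  exact: (@cvg_mulmx _ _ _ _ _ _ _ N (fun=> W) _ _ (@N_continuous c0 x0) (cvg_cst _)).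
have /cvgrPdist_le/(_ e e0)/nbhs_ballP[d d0 dN] := NW.
(* Halving puts the closed ball, on which Banach's theorem will run, inside the open ball of radius
   [d]. *)
have d2 : 0 < d / 2 by rewrite divr_gt0.
have d2d : d / 2 < d by rewrite ltr_pdivrMr// ltr_pMr// ltr1n.
exists (d / 2) => // c x x' cd xd xd' y.
rewrite -mulmxA -{1}[y]mulmx1 -mulmxBr (le_trans (ler_mx_normM _ _))//.
rewrite ler_wpM2r//.
have : `|(1%:M : 'M[R]_m) - N (c, (x, x')) *m W| <= e.
  apply: (dN (c, (x, x'))); split => /=.
    by rewrite -ball_normE /=; exact: lt_trans cd _.
  by split => /=; rewrite -ball_normE /=; [exact: le_lt_trans xd _|exact: le_lt_trans xd' _].
move=> /(ler_wpM2l (ler0n R m))/le_trans; apply.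
by rewrite /e mulrCA ger_pMr// ler_pdivrMr// mul1r lerDl.
Qed.

Let displacement_cvg (c : 'rV[R]_n) p (A : 'M[R]_(n, p)) :
  (c' - c) *m A @[c' --> c] --> (0 : 'rV[R]_p).
Proof.
have c0c : c' - c @[c' --> c] --> (0 : 'rV[R]_n).
  by rewrite -(subrr c); exact: (@cvgB _ _ _ (nbhs c) _ id (fun=> c) _ _ cvg_id (cvg_cst _)).
rewrite -(mul0mx _ A).
exact: (cvg_comp _ _ c0c (@continuous_mulmxr _ _ _ _ _ _)).
Qed.

Lemma implicit_function : exists2 f : 'rV[R]_n -> 'rV[R]_m, f c0 = x0 &
  \forall c \near c0, [/\ G c (f c) = 0, N (c, (f c, f c)) \in unitmx,
    differentiable f c, 'J f c = - (L (f c) *m invmx (N (c, (f c, f c)))) &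
    {for c, continuous (fun z => 'J f z)}].
Proof.
have [r r0 Wr] := Wnear.
have r2 : 0 < r / 2 by rewrite divr_gt0.
(* The second condition bounds the first displacement [x0 - T x0] of the iteration below, so that
   [T] maps the closed ball [B] into itself: [r / 2] from contraction plus [r / 2] from this. *)
pose U c := `|c0 - c| < r /\ `|G c x0 *m W| <= r / 2.
pose B x := `|x0 - x| <= r.
have Bx0 : B x0 by rewrite /B subrr normr0 ltW.
have Uc0 : U c0 by split; rewrite ?G0 ?mul0mx ?subrr normr0// ltW.
have Unear : \forall c \near c0, U c.
  apply: filterI.
    by apply/nbhs_ballP; exists r => //= c; rewrite -ball_normE.
  have /cvgrPdist_le/(_ _ r2) := @displacement_cvg c0 _ (L x0 *m W).
  apply: filterS => c; rewrite sub0r normrN.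
  have := GE c0 c x0 x0; rewrite G0 subr0 subrr mul0mx addr0 => ->.
  by rewrite mulmxA.
have Gx c c' x x' : G c x = 0 -> G c' x' = 0 ->
    (x' - x) *m N (c', (x, x')) = - ((c' - c) *m L x).
  move=> Gcx Gcx'; have := GE c c' x x'; rewrite Gcx Gcx' subrr.
  by move/esym/eqP; rewrite addrC addr_eq0 => /eqP.
(* For two roots, [Wnear] reads [|a + b| <= |a| / 2] with [a = x' - x], whence [|a| <= 2 |b|]. The
   case [c = c'] gives uniqueness of the root in [B]; the general case gives continuity of [f]. *)
have lip c c' x x' : U c' -> B x -> B x' -> G c x = 0 -> G c' x' = 0 ->
    `|x' - x| <= 2 * `|(c' - c) *m L x *m W|.
  move=> [Uc' _] Bx Bx' Gcx Gcx'.
  have := Wr _ _ _ Uc' Bx Bx' (x' - x); rewrite (Gx c)// mulNmx opprK.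
  set a := x' - x; set b := _ *m W => ab.
  have := ler_normB (a + b) b; rewrite addrK => /le_trans/(_ (lerD ab (lexx _))).
  rewrite -lerBlDl -[X in X - _]mul1r -mulrBl.
  have -> : (1 - 2^-1 : R) = 2^-1 by rewrite {1}[1]splitr mul1r addrK.
  by rewrite ler_pdivrMl.
have ex c : U c -> exists x, B x /\ G c x = 0.
  (* A Newton step with the derivative frozen at the base point; as [W] is invertible, its fixed
     points are the zeros of [G c]. *)
  move=> [Uc GU]; pose T x := x - G c x *m W.
  have TE x y : T x - T y = (x - y) - (x - y) *m N (c, (y, x)) *m W.
    have := GE c c y x; rewrite subrr mul0mx add0r => <-.
    by rewrite mulmxBl /T !opprD !opprK addrACA.
  have Tlip x y : B x -> B y -> `|T x - T y| <= 2^-1 * `|x - y|.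
    by move=> Bx By; rewrite TE; exact: Wr.
  have h1 : (2^-1 : R) < 1 by rewrite invf_lt1// ltr1n.
  have [|x Bx|x Bx xE] := @contraction_fixpoint R 'rV[R]_m B T (2^-1)%:nng x0 h1 _ Bx0 _ Tlip.
  - exact: (@closed_closed_ball_ _ _ x0 r).
  - rewrite /B; have -> : x0 - T x = (T x0 - T x) + G c x0 *m W by rewrite /T addrAC subrK.
    rewrite (le_trans (ler_normD _ _))// [leRHS]splitr lerD//.
    by rewrite (le_trans (Tlip _ _ Bx0 Bx))// mulrC ler_wpM2r.
  exists x; split => //.
  have : G c x *m W = 0 by move/eqP: xE; rewrite -subr_eq0 opprB addrC subrK => /eqP.
  move/(congr1 (mulmx^~ (N (c0, (x0, x0))))).
  by rewrite /W mulmxKV// mul0mx.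
pose f c := xget x0 [set x | B x /\ G c x = 0].
have fP c : U c -> B (f c) /\ G c (f c) = 0.
  by move=> /ex [x xP]; exact: (@xgetPex _ x0 [set x | B x /\ G c x = 0]) (ex_intro _ x xP).
have fc0 : f c0 = x0.
  have [Bf Gf] := fP _ Uc0.
  have := lip _ _ _ _ Uc0 Bx0 Bf G0 Gf; rewrite subrr !mul0mx normr0 mulr0.
  by rewrite normr_le0 subr_eq0 => /eqP.
(* A kernel vector [y] would satisfy [|y| <= |y| / 2]. *)
have N_unit c x x' : U c -> B x -> B x' -> N (c, (x, x')) \in unitmx.
  move=> [Uc _] Bx Bx'; rewrite -row_free_unit; apply: inj_row_free => y yN.
  have := Wr _ _ _ Uc Bx Bx' y; rewrite yN mul0mx subr0 => yy.
  apply/eqP; rewrite -normr_le0 leNgt; apply/negP => y0.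
  by move: yy; rewrite ler_pMl// leNgt invf_lt1// ltr1n.
have f_cont c : (\forall c' \near c, U c') -> {for c, continuous f}.
  move=> Uc; have [Bf Gf] := fP _ (nbhs_singleton Uc).
  apply/(@cvgrPdist_le _ _ _ (nbhs c)) => e e0.
  have e2 : 0 < e / 2 by rewrite divr_gt0.
  have := @displacement_cvg c _ (L (f c) *m W).
  move=> /cvgrPdist_le/(_ _ e2); apply: filterS2 Uc => c' Uc'.
  have [Bf' Gf'] := fP _ Uc'.
  rewrite sub0r normrN mulmxA => ce; rewrite distrC.
  by rewrite (le_trans (lip _ _ _ _ Uc' Bf Bf' Gf Gf'))// mulrC -ler_pdivlMr.
have N_cvg (g h : 'rV[R]_n -> 'rV[R]_m) c : (\forall c' \near c, U c') ->
    g c' @[c' --> c] --> f c -> h c' @[c' --> c] --> f c ->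
    invmx (N (c', (g c', h c'))) @[c' --> c] --> invmx (N (c, (f c, f c))).
  move=> Uc gc hc; have [Bf Gf] := fP _ (nbhs_singleton Uc).
  apply: (@cvg_invmx _ _ (nbhs c)); first by apply: N_unit => //; exact: nbhs_singleton Uc.
  apply: (cvg_comp (fun c' => (c', (g c', h c'))) N _ (@N_continuous c (f c))).
  exact: (cvg_pair cvg_id (cvg_pair gc hc)).
have fJ c : (\forall c' \near c, U c') -> differentiable f c /\
    'J f c = - (L (f c) *m invmx (N (c, (f c, f c)))).
  move=> Uc; have [Bf Gf] := fP _ (nbhs_singleton Uc).
  (* Solving the increment identity between two roots for [f c' - f c] gives this slope without
     remainder. *)
  apply: (@slope_jacobian _ _ _ _ _ (fun c' => - (L (f c) *m invmx (N (c', (f c, f c')))))).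
    apply: filterS Uc => c' Uc'; have [Bf' Gf'] := fP _ Uc'.
    rewrite mulmxN mulmxA -mulNmx -(Gx _ _ _ _ Gf Gf') mulmxK//.
    exact: N_unit.
  apply: (@cvgN _ _ _ (nbhs c)); apply: (@cvg_mulmx _ _ (nbhs c)); first exact: cvg_cst.
  by apply: (N_cvg (fun=> f c) f c Uc _ (f_cont c Uc)); exact: (@cvg_cst _ (f c) _ (nbhs c)).
exists f => //.
(* Each [c] near [c0] has itself a whole neighbourhood in [U], as needed to differentiate [f] at [c]
   and not only at [c0]. *)
have := near_join Unear; apply: filterS => c Uc.
have [Bf Gf] := fP _ (nbhs_singleton Uc); have [df Jf] := fJ _ Uc.
split => //; first by apply: N_unit => //; exact: nbhs_singleton Uc.
rewrite /prop_for /continuous_at Jf; apply: cvg_trans.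
  apply: (@near_eq_cvg _ _ (nbhs c) _
    (fun z => - (L (f z) *m invmx (N (z, (f z, f z))))) (fun z => 'J f z)).
  by have := near_join Uc; apply: filterS => z /fJ[_ ->].
have fc := f_cont _ Uc.
apply: (@cvgN _ _ _ (nbhs c)); apply: (@cvg_mulmx _ _ (nbhs c)); last exact: N_cvg.
exact: (cvg_comp f L fc (L_continuous (x:=f c))).
Qed.

End implicit_function.

(** * Derivatives of convex functions and difference quotients *)

Section real_slope.
Context {R : realType}.
Implicit Types (f : R -> R) (x v c : R).

(** Passing to the limit in right difference quotients along [v]. The restriction [h < 1] lets
    [x + h * v] be a convex combination of [x] and [x + v]. *)
Lemma derive1_ge_right f x v c : derivable f x 1 ->
  (forall h, 0 < h < 1 -> h * c <= f (x + h * v) - f x) -> c <= v * derive1 f x.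
Proof.
move=> /derivable1_diffP df fc.
have -> : v * derive1 f x = 'D_v f x.
  by rewrite derive1E' // deriveE // -[in RHS](mulr1 v) linearZ.
have /cvg_dnbhs_at_right fr := (@diff_derivable _ _ _ _ _ v df).
apply: (cvgr_to_ge fr).
near=> h.
have h0 : 0 < h by near: h; exact: nbhs_right_gt.
have h1 : h < 1 by near: h; exact: nbhs_right_lt.
by rewrite /= ler_pdivlMl// [_ + x]addrC; apply: fc; rewrite h0.
Unshelve. all: by end_near. Qed.

Lemma nondecreasing_derive1_ge0 f x : derivable f x 1 ->
  {homo f : s t / s <= t} -> 0 <= derive1 f x.
Proof.
move=> df fh; rewrite -(mul1r (derive1 f x)); apply: derive1_ge_right => // h /andP[h0 _].
by rewrite mulr0 mulr1 subr_ge0 fh// lerDl ltW.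
Qed.

Lemma convex_tangent f x y : convex_fun f -> derivable f x 1 ->
  (y - x) * derive1 f x <= f y - f x.
Proof.
move=> cf df; rewrite -lerN2 -mulrN -derive1N//.
apply: derive1_ge_right => [|h /andP[h0 h1]]; first exact: derivableN.
have := cf y x h (ltW h0) (ltW h1).
have -> : h * y + (1 - h) * x = x + h * (y - x) by ring.
by rewrite !fctE; lra.
Qed.

Lemma convex_derive1_homo f : convex_fun f -> (forall x, derivable f x 1) ->
  {homo derive1 f : s t / s <= t}.
Proof.
move=> cf df s t; rewrite le_eqVlt => /predU1P[->//|st].
have := convex_tangent t cf (df s); have := convex_tangent s cf (df t).
have st0 : 0 < t - s by rewrite subr_gt0.
move=> h1 h2; rewrite -(ler_pM2l st0); lra.
Qed.

(** A monotone function with equal values at [s] and [t] is constant between them, so its one-sided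
    quotients at [s] towards [t] vanish; applying the one-sided bound to [f] and [- f] pins the
    derivative. *)
Lemma homo_flat_derive1 f s t : derivable f s 1 ->
  {homo f : s t / s <= t} -> f s = f t -> s != t -> derive1 f s = 0.
Proof.
move=> df fh fst st; apply/eqP.
have fE h : 0 < h < 1 -> f (s + h * (t - s)) = f s.
  move=> /andP[h0 h1]; apply/eqP; rewrite eq_le.
  by case: (ltgtP s t) st => // st _; [rewrite {1}fst|rewrite {2}fst]; rewrite !fh//; nra.
have ge0 : 0 <= (t - s) * derive1 f s.
  by apply: derive1_ge_right => // h /fE ->; rewrite mulr0 subrr.
have le0 : 0 <= - (t - s) * derive1 f s.
  rewrite mulNr -mulrN -derive1N//; apply: derive1_ge_right => [|h /fE fsh].
    exact: derivableN.
  by rewrite !fctE fsh mulr0 subrr.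
have /eqP : (t - s) * derive1 f s = 0 by lra.
by rewrite mulf_eq0 subr_eq0 eq_sym (negbTE st).
Qed.

(** The diagonal value makes the increment identity hold without exception and the quotient
    continuous there. *)
Definition slope f (p : R * R) : R :=
  if p.1 == p.2 then derive1 f p.1 else (f p.2 - f p.1) / (p.2 - p.1).

Lemma slopeE f s t : f t - f s = slope f (s, t) * (t - s).
Proof.
rewrite /slope /=; case: eqVneq => [->|st]; first by rewrite !subrr mulr0.
by rewrite divfK// subr_eq0 eq_sym.
Qed.

Lemma slope_diag f s : slope f (s, s) = derive1 f s.
Proof. by rewrite /slope eqxx. Qed.

Lemma slope_mean f s t : (forall x, derivable f x 1) ->
  exists2 x, (s <= x <= t) || (t <= x <= s) & slope f (s, t) = derive1 f x.
Proof.
move=> df.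
have mvt a b : a < b -> exists2 x, a <= x <= b & f b - f a = derive1 f x * (b - a).
  move=> ab; have [||x xab fx] := @MVT R f (derive1 f) a b ab.
  - by move=> x _; rewrite derive1E; exact: derivableP.
  - apply: continuous_subspaceT => x.
    by apply: differentiable_continuous; exact/derivable1_diffP.
  by exists x; rewrite // !(itvP xab).
rewrite /slope /=; case: (ltgtP s t) => [st|ts|->].
- have [x xst fx] := mvt _ _ st; exists x; first by rewrite xst.
  by rewrite fx mulfK// subr_eq0 gt_eqF.
- have [x xst fx] := mvt _ _ ts; exists x; first by rewrite xst orbT.
  by rewrite -opprB fx -[t - s]opprB invrN mulrNN mulfK// subr_eq0 gt_eqF.
- by exists t; rewrite ?lexx.
Qed.

(** By the mean value theorem a quotient near [(s, s)] is a derivative at an intermediate point,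
    which also lies near [s]. *)
Lemma slope_continuous f s : (forall x, derivable f x 1) -> continuous (derive1 f) ->
  {for (s, s), continuous (slope f)}.
Proof.
move=> df cf; apply/cvgrPdist_le => e e0; rewrite slope_diag.
have /cvgrPdist_le/(_ e e0)/nbhs_ballP[d d0 dP] := cf s.
exists (ball s d, ball s d) => [|[a b] [/= sa sb]].
  by split; exact: nbhsx_ballx.
have [x xab ->] := slope_mean a b df; apply: dP.
move: sa sb; rewrite -!ball_normE /= !ltr_distlC => /andP[a1 a2] /andP[b1 b2].
by apply/andP; case/orP: xab => /andP[]; split; lra.
Qed.

End real_slope.

(** * The optimality system *)

Section kkt.
Context {R : realType} {n : nat}.
Variables (y : 'I_n -> R) (K : 'M[R]_n) (l : R -> R).
Hypothesis y1 : forall i, y i = 1 \/ y i = -1.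
Hypothesis K_sym : K^T = K.
Hypothesis K_posdef : forall x : 'rV[R]_n, x != 0 -> 0 < (x *m K *m x^T) ord0 ord0.
Hypothesis l_convex : convex_fun l.
Hypothesis l_C2 : C2 l.
Implicit Types (a c d : 'rV[R]_n) (b : R) (x z : 'rV[R]_(n + 1)).

Let l_derivable s : derivable l s 1. Proof. by case: l_C2. Qed.
Let dl_derivable s : derivable (derive1 l) s 1. Proof. by case: l_C2 => _ []. Qed.
Let ddl_continuous : continuous (derive1 (derive1 l)).
Proof. by case: l_C2 => _ []. Qed.
Let dl_continuous : continuous (derive1 l).
Proof. by move=> s; apply: differentiable_continuous; exact/derivable1_diffP. Qed.
Let dl_homo : {homo derive1 l : s t / s <= t}.
Proof. exact: (convex_derive1_homo l_convex l_derivable). Qed.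
Let yy i : y i * y i = 1.
Proof. by case: (y1 i) => ->; rewrite ?mulrNN mulr1. Qed.

Definition scores a b i := y i * margin K a b i.
Definition loss_grad a b : 'rV[R]_n := \row_i (y i * derive1 l (scores a b i)).
Definition loss_curv c a b : 'rV[R]_n :=
  \row_i (c ord0 i * derive1 (derive1 l) (scores a b i)).
(** The gradient of the objective in [a] is [residual c a b *m K]; the invertible factor [K] is
    dropped. *)
Definition residual c a b := a + c *m diag_mx (loss_grad a b).

Lemma marginE a b i : margin K a b i = (a *m K) ord0 i + b.
Proof. by rewrite /margin mxE; congr (_ + _); apply: eq_bigr => j _; rewrite mulrC. Qed.

Lemma loss_gradE a b i : loss_grad a b ord0 i = y i * derive1 l (scores a b i).
Proof. by rewrite mxE. Qed.

Lemma residualE c a b i :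
  residual c a b ord0 i = a ord0 i + c ord0 i * loss_grad a b ord0 i.
Proof. by rewrite /residual mul_mx_diag !mxE. Qed.

Lemma posdef_ge0 a : 0 <= (a *m K *m a^T) ord0 ord0.
Proof.
by have [->|/K_posdef/ltW//] := eqVneq a 0; rewrite !mul0mx mxE.
Qed.

Lemma posdef_eq0 a : (a *m K *m a^T) ord0 ord0 <= 0 -> a = 0.
Proof. by apply: contraTeq => /K_posdef; rewrite ltNge. Qed.

(** The quadratic part is expanded exactly, and each loss term, weighted by [c >= 0], lies above its
    tangent. The surviving quadratic term is what later forces equality of the [a] parts. *)
Lemma objective_ge c a b a' b' : (forall i, 0 <= c ord0 i) ->
  2^-1 * ((a' - a) *m K *m (a' - a)^T) ord0 ord0
  + ((a' - a) *m K *m (residual c a b)^T) ord0 ord0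
  + (b' - b) * \sum_i c ord0 i * loss_grad a b ord0 i
  <= objective K y l c a' b' - objective K y l c a b.
Proof.
move=> c0; pose d := a' - a.
have quad (e : 'rV[R]_n) : 2^-1 * ((a + e) *m K *m (a + e)^T) ord0 ord0
    - 2^-1 * (a *m K *m a^T) ord0 ord0 =
    2^-1 * (e *m K *m e^T) ord0 ord0 + (e *m K *m a^T) ord0 ord0.
  have sym : (a *m K *m e^T) ord0 ord0 = (e *m K *m a^T) ord0 ord0.
    by rewrite -[in LHS](trmxK (a *m K *m e^T)) mxE !trmx_mul trmxK K_sym mulmxA.
  have -> : (a + e) *m K *m (a + e)^T = a *m K *m a^T + a *m K *m e^T +
      (e *m K *m a^T + e *m K *m e^T).
    by rewrite raddfD /= !mulmxDl !mulmxDr.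
  rewrite [X in _ * X - _]mxE [X in _ * (X + _)]mxE [X in _ * (_ + X)]mxE sym.
  by field.
have lin : (d *m K *m (residual c a b)^T) ord0 ord0
    + (b' - b) * \sum_i c ord0 i * loss_grad a b ord0 i =
    (d *m K *m a^T) ord0 ord0 + \sum_i c ord0 i *
      ((scores a' b' i - scores a b i) * derive1 l (scores a b i)).
  rewrite [X in X + _ = _]mxE [X in _ = X + _]mxE mulr_sumr -!big_split /=.
  apply: eq_bigr => i _; rewrite [_^T _ _]mxE residualE [a^T _ _]mxE loss_gradE.
  rewrite /scores !marginE.
  have -> : (d *m K) ord0 i = (a' *m K) ord0 i - (a *m K) ord0 i.
    by rewrite /d mulmxBl !mxE.
  by ring.
have := quad d; rewrite {1 2}/d [a + _]addrC subrK => {}quad.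
rewrite -/d -addrA lin /objective.
rewrite opprD addrACA quad -addrA lerD2l lerD2l -sumrB; apply: ler_sum => i _.
by rewrite -[leRHS]mulrBr ler_wpM2l// convex_tangent.
Qed.

(** Once the residual vanishes, the [b]-derivative of the objective is minus the sum of the entries
    of [a]. Stating it through [a] alone produces the last row of the KKT matrix. *)
Definition stationary c a b :=
  residual c a b = 0 /\ a *m const_mx 1 = 0 :> 'M[R]_1.

Lemma residual0_sum c a b : residual c a b = 0 ->
  \sum_i c ord0 i * loss_grad a b ord0 i = - (a *m const_mx 1 : 'M[R]_1) ord0 ord0.
Proof.
move=> r0; rewrite mxE -sumrN; apply: eq_bigr => i _; rewrite [const_mx _ _ _]mxE mulr1.
have := residualE c a b i; rewrite r0 mxE => /esym/eqP.
by rewrite addrC addr_eq0 => /eqP.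
Qed.

(* [objective_ge] based at [(a + h p, b + h q)] bounds its own linear part [phi h] from
   below by [0]; let [h] tend to [0] and take [(p, q)] opposite to the gradient. *)
Lemma solution_stationary c a b : (forall i, 0 <= c ord0 i) ->
  is_solution K y l c a b -> stationary c a b.
Proof.
move=> c0 sol.
pose p := - residual c a b; pose q := - \sum_i c ord0 i * loss_grad a b ord0 i.
pose phi h := (p *m K *m (residual c (a + h *: p) (b + h * q))^T) ord0 ord0 +
  q * \sum_i c ord0 i * loss_grad (a + h *: p) (b + h * q) ord0 i.
(* Going back from the perturbed point to the minimizer cannot increase the objective, and the
   displacement is [- h] times [(p, q)]. *)
have phi_ge0 h : 0 < h -> 0 <= phi h.
  move=> h0.
  have := objective_ge (a + h *: p) (b + h * q) a b c0.
  have := sol (a + h *: p) (b + h * q).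
  have -> : a - (a + h *: p) = (- h) *: p by rewrite opprD addrA subrr sub0r scaleNr.
  have -> : b - (b + h * q) = (- h) * q by ring.
  have := posdef_ge0 ((- h) *: p); set t := (_ *m K *m _) ord0 ord0 => t0.
  rewrite -2!scalemxAl [X in _ + X + _ <= _]mxE -mulrA -addrA -mulrDr -/(phi h).
  move=> sol1 sol2; rewrite -(pmulr_rge0 _ h0); lra.
have phi_cvg : phi h @[h --> 0^'+] --> phi 0.
  apply: cvg_at_right_filter.
  pose psi i h := c ord0 i *
    (y i * derive1 l (y i * (margin K a b i + h * ((p *m K) ord0 i + q)))).
  have -> : phi = fun h => \sum_i (p *m K) ord0 i * (a ord0 i + h * p ord0 i + psi i h)
      + q * \sum_i psi i h.
    have psiE i h : c ord0 i * loss_grad (a + h *: p) (b + h * q) ord0 i = psi i h.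
      rewrite loss_gradE /scores /psi !marginE mulmxDl -scalemxAl.
      have -> : (a *m K + h *: (p *m K)) ord0 i = (a *m K) ord0 i + h * (p *m K) ord0 i.
        by rewrite mxE; congr (_ + _); rewrite mxE.
      by rewrite (mulrDr h) addrACA.
    apply/funext => h; rewrite /phi; congr (_ + q * _); last exact: eq_bigr.
    rewrite mxE; apply: eq_bigr => i _; rewrite [_^T _ _]mxE residualE psiE.
    by congr (_ * (_ + _)); rewrite mxE; congr (_ + _); rewrite mxE.
  have psi_cvg i : psi i h @[h --> (0 : R)] --> psi i 0.
    have arg : y i * (margin K a b i + h * ((p *m K) ord0 i + q)) @[h --> (0 : R)] -->
        y i * (margin K a b i + 0 * ((p *m K) ord0 i + q)).
      by apply: cvgMl_tmp; apply: cvgD; [exact: cvg_cst|apply: cvgMr_tmp; exact: cvg_id].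
    by do 2! apply: cvgMl_tmp; exact: (cvg_comp _ _ arg (@dl_continuous _)).
  apply: cvgD; last by apply: cvgMl_tmp; apply: cvg_bigsum => i _.
  apply: cvg_bigsum => i _; apply: cvgMl_tmp; apply: cvgD => //.
  by apply: cvgD; [exact: cvg_cst|apply: cvgMr_tmp; exact: cvg_id].
have : 0 <= phi 0.
  apply: (cvgr_to_ge phi_cvg); near=> h; apply: phi_ge0.
  by near: h; exact: nbhs_right_gt.
(* Now [phi 0] is minus the [K]-square of the residual minus [s * s]; being nonnegative, it makes
   both vanish. *)
rewrite /phi scale0r mul0r !addr0 /p !mulNmx [(- _ : 'M[R]_1) ord0 ord0]mxE /q.
set s := \sum_i _; set r := residual c a b => rs.
have s2 : 0 <= s * s by rewrite -expr2 sqr_ge0.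
have rK := posdef_ge0 r.
have r0 : r = 0 by apply: posdef_eq0; lra.
have {}s2 : s * s = 0 by lra.
have s0 : s = 0 by move/eqP: s2; rewrite mulf_eq0 orbb => /eqP.
split => //; apply/matrixP => i j; rewrite !ord1 [RHS]mxE.
by apply/eqP; rewrite -oppr_eq0 -(residual0_sum r0) -/s s0.
Unshelve. all: by end_near. Qed.

Lemma stationary_solution c a b : (forall i, 0 <= c ord0 i) ->
  stationary c a b -> is_solution K y l c a b.
Proof.
move=> c0 [r0 s0] a' b'; rewrite -subr_ge0.
apply: le_trans (objective_ge a b a' b' c0).
rewrite residual0_sum// r0 s0 trmx0 mulmx0 ![(0 : 'M[R]_1) _ _]mxE.
by rewrite oppr0 mulr0 !addr0 mulr_ge0// posdef_ge0.
Qed.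

(* The quadratic term forces [a' = a]; stationarity at both biases then makes [l'] take
   equal values at distinct scores, hence flat there, against [v != 0]. *)
Lemma solution_unique c a b a' b' : (forall i, 0 <= c ord0 i) ->
  loss_curv c a b != 0 -> is_solution K y l c a b -> is_solution K y l c a' b' ->
  a' = a /\ b' = b.
Proof.
move=> c0 v0 sol sol'; have [r0 s0] := solution_stationary c0 sol.
have aE : a' = a.
  apply/eqP; rewrite -subr_eq0; apply/eqP/posdef_eq0.
  have := objective_ge a b a' b' c0; rewrite residual0_sum// r0 s0 trmx0 mulmx0.
  rewrite ![(0 : 'M[R]_1) _ _]mxE oppr0 mulr0 !addr0.
  have := sol' a b; lra.
split=> //; apply: contraNeq v0 => bb; apply/eqP/rowP => i; rewrite !mxE.
have [r0' _] := solution_stationary c0 sol'; rewrite aE in r0'.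
have [->|ci] := eqVneq (c ord0 i) 0; first by rewrite mul0r.
have := residualE c a b i; have := residualE c a b' i.
rewrite r0 r0' !loss_gradE => -> /addrI/(mulfI ci).
have yi : y i != 0 by case: (y1 i) => ->; rewrite ?oppr_eq0 oner_eq0.
move/(mulfI yi) => ss; rewrite (@homo_flat_derive1 _ _ _ (scores a b' i))// ?mulr0//.
by rewrite /scores !marginE (inj_eq (mulfI yi)) (inj_eq (addrI _)) eq_sym.
Qed.

(** * Invertibility of the KKT matrix and its dependence on the weights *)

Definition bias x : R := x ord0 (rshift n ord0).

Lemma row_mx_bias x : row_mx (lsubmx x) (bias x)%:M = x.
Proof.
rewrite -[RHS]hsubmxK; congr row_mx; apply/rowP => i.
by rewrite ord1 !mxE eqxx.
Qed.

Lemma kkt_matrix_tr d x :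
  x *m (kkt_matrix K d)^T =
  row_mx (\row_i (lsubmx x ord0 i + d ord0 i * margin K (lsubmx x) (bias x) i))
         (lsubmx x *m const_mx 1).
Proof.
rewrite -{1}[x]row_mx_bias /kkt_matrix tr_block_mx mul_row_block trmx0 trmx_const.
rewrite trmxK mulmx0 addr0; congr row_mx; apply/rowP => i.
rewrite linearD /= trmx1 trmx_mul K_sym tr_diag_mx mulmxDr mulmx1 mulmxA.
rewrite mul_mx_diag mul_scalar_mx !mxE marginE mxE; ring.
Qed.

(** A kernel vector [(p, q)] has [p = - d . margin] and entries of [p] summing to zero. Pairing [p]
    with [p *m K] gives minus a weighted sum of squared margins, so [p = 0]; then [q * d = 0] forces
    [q = 0]. *)
Lemma kkt_matrix_unit d : (forall i, 0 <= d ord0 i) -> d != 0 ->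
  kkt_matrix K d \in unitmx.
Proof.
move=> d0 dn0; rewrite -unitmx_tr -row_free_unit; apply: inj_row_free => x.
rewrite kkt_matrix_tr -[X in _ = X]row_mx0 => /eq_row_mx[/rowP xd x1].
set p := lsubmx x in xd x1; set q := bias x in xd.
have pE i : p ord0 i = - (d ord0 i * margin K p q i).
  by have := xd i; rewrite !mxE => /eqP; rewrite addr_eq0 => /eqP.
have p0 : p = 0.
  apply: posdef_eq0; rewrite mxE.
  have -> : \sum_j (p *m K) ord0 j * p^T j ord0 =
      - \sum_i d ord0 i * margin K p q i ^+ 2 - q * \sum_i p ord0 i.
    rewrite mulr_sumr -!sumrN -big_split /=; apply: eq_bigr => i _.
    rewrite [_^T _ _]mxE.
    have -> : (p *m K) ord0 i = margin K p q i - q by rewrite marginE addrK.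
    by rewrite mulrBl {1}pE mulrN expr2 mulrA mulrC; ring.
  have -> : \sum_i p ord0 i = 0.
    have /matrixP/(_ ord0 ord0) := x1; rewrite mxE [RHS]mxE => e; rewrite -[RHS]e.
    by apply: eq_bigr => i _; rewrite [const_mx _ _ _]mxE mulr1.
  rewrite mulr0 subr0 oppr_le0; apply: sumr_ge0 => i _.
  by rewrite mulr_ge0// sqr_ge0.
have q0 : q = 0.
  apply: contra_neq_eq dn0 => q0; apply/rowP => i.
  have /eqP := pE i; rewrite marginE p0 mul0mx !mxE add0r eq_sym oppr_eq0 mulf_eq0.
  by rewrite (negbTE q0) orbF => /eqP.
by rewrite -[x]row_mx_bias -/p -/q p0 q0 raddf0 row_mx0.
Qed.

(** The vector [(0, 1)] is in the kernel. Contraposed, invertibility of the KKT matrix near [c]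
    shows that the curvature vector stays nonzero there. *)
Lemma kkt_matrix0_unit : kkt_matrix K 0 \notin unitmx.
Proof.
rewrite -unitmx_tr; apply/negP => u.
pose x : 'rV[R]_(n + 1) := row_mx 0 1%:M.
have : x *m (kkt_matrix K 0)^T = 0.
  rewrite kkt_matrix_tr /x row_mxKl mul0mx -[RHS]row_mx0; congr row_mx.
  by apply/rowP => i; rewrite !mxE mul0r addr0.
move/(congr1 (mulmx^~ (invmx (kkt_matrix K 0)^T))).
rewrite mulmxK// mul0mx => /matrixP/(_ ord0 (rshift n ord0)).
by rewrite /x row_mxEr !mxE eqxx => /eqP; rewrite oner_eq0.
Qed.

Lemma kkt_matrix_affine d : kkt_matrix K d = kkt_matrix K 0 +
  col_mx 1%:M 0 *m diag_mx d *m row_mx K (const_mx 1).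
Proof.
rewrite mul_col_mx mul1mx mul0mx mul_col_row !mul0mx /kkt_matrix add_block_mx.
rewrite !addr0 raddf0 mul0mx addr0 trmx0 add0r; congr block_mx.
by apply/matrixP => i j; rewrite mul_diag_mx !mxE mulr1 ord1.
Qed.

Lemma cvg_kkt_matrix (T : Type) (F : set_system T) (FF : Filter F)
    (f : T -> 'rV[R]_n) d :
  f t @[t --> F] --> d -> (kkt_matrix K (f t))^T @[t --> F] --> (kkt_matrix K d)^T.
Proof.
move=> fd; rewrite kkt_matrix_affine; under eq_cvg do rewrite kkt_matrix_affine.
apply: cvg_trmx; apply: cvgD; first exact: cvg_cst.
apply: cvg_mulmx; last exact: cvg_cst.
by apply: cvg_mulmx; [exact: cvg_cst|exact: cvg_diag_mx].
Qed.

(** * The optimality system as an instance of the implicit function theorem *)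

Let dl := derive1 l.
Let s x i := scores (lsubmx x) (bias x) i.
Let G c x : 'rV[R]_(n + 1) := row_mx (residual c (lsubmx x) (bias x)) (lsubmx x *m const_mx 1).
Let L x : 'M[R]_(n, n + 1) := row_mx (diag_mx (loss_grad (lsubmx x) (bias x))) 0.
Let N (p : 'rV[R]_n * ('rV[R]_(n + 1) * 'rV[R]_(n + 1))) :=
  (kkt_matrix K (\row_i (p.1 ord0 i * slope dl (s p.2.1 i, s p.2.2 i))))^T.

Let N_diag c x : N (c, (x, x)) = (kkt_matrix K (loss_curv c (lsubmx x) (bias x)))^T.
Proof.
by rewrite /N /=; congr (_ _)^T; apply/rowP => i; rewrite !mxE slope_diag.
Qed.

(** With [u], [u'] the loss gradients at [x], [x'], the first block splits as
    [c' u' - c u = (c' - c) u + c' (u' - u)], and [u' - u] is a slope of [l'] times a score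
    increment; the second block is linear. *)
Let GE c c' x x' :
  G c' x' - G c x = (c' - c) *m L x + (x' - x) *m N (c', (x, x')).
Proof.
rewrite /N kkt_matrix_tr /L mul_mx_row mulmx0 /G opp_row_mx !add_row_mx add0r.
rewrite -mulmxBl -linearB /=; congr row_mx; apply/rowP => i.
have subE (u w : 'rV[R]_n) j : (u - w) ord0 j = u ord0 j - w ord0 j by rewrite !mxE.
have addE (u w : 'rV[R]_n) j : (u + w) ord0 j = u ord0 j + w ord0 j by rewrite !mxE.
have rowE (u : 'I_n -> R) j : (\row_k u k) ord0 j = u j by rewrite mxE.
rewrite subE !residualE addE !rowE mul_mx_diag [X in _ = X + _]mxE !subE loss_gradE.
(* Since [y i * y i = 1], the label turns a score increment back into a margin increment. *)
have -> : margin K (lsubmx (x' - x)) (bias (x' - x)) i = y i * (s x' i - s x i).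
  rewrite /s /scores -mulrBr mulrA yy mul1r !marginE linearB /= mulmxBl subE /bias.
  by rewrite [(x' - x) _ _]mxE [(- x) _ _]mxE; ring.
rewrite -[_ * slope _ _ * _]mulrA [slope _ _ * _]mulrCA -slopeE linearB /= subE /dl /s.
by ring.
Qed.

Let margin_cvg x i : margin K (lsubmx z) (bias z) i @[z --> x] -->
  margin K (lsubmx x) (bias x) i.
Proof.
have coordx j : z ord0 j @[z --> x] --> x ord0 j by exact: (@coord_continuous _ _ _ ord0 j x).
apply: (@cvgD _ _ _ (nbhs x)); last exact: coordx.
apply: (@cvg_bigsum _ _ (nbhs x)) => j _; apply: (@cvgMl_tmp _ _ (nbhs x)); rewrite mxE.
by under eq_cvg do rewrite mxE; exact: coordx.
Qed.

Let s_continuous i : continuous (s^~ i).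
Proof. by move=> x; apply: (@cvgMl_tmp _ _ (nbhs x)); exact: margin_cvg. Qed.

Let N_continuous c x : {for (c, (x, x)), continuous N}.
Proof.
apply: (@cvg_kkt_matrix _ (nbhs (c, (x, x)))).
apply: (@cvg_mx _ _ (nbhs (c, (x, x)))) => i j; rewrite mxE.
under eq_cvg do rewrite mxE.
apply: (@cvgM _ _ (nbhs (c, (x, x)))).
  apply: (@cvg_coord _ _ (nbhs (c, (x, x)))); exact: cvg_fst.
have slc := @slope_continuous R dl (s x j) dl_derivable ddl_continuous.
have sj (g : 'rV[R]_n * ('rV[R]_(n + 1) * 'rV[R]_(n + 1)) -> 'rV[R]_(n + 1)) :
    g p @[p --> (c, (x, x))] --> x -> s (g p) j @[p --> (c, (x, x))] --> s x j.
  by move=> gx; exact: (cvg_comp _ _ gx (s_continuous (i:=j) (x:=x))).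
have s1 : s p.2.1 j @[p --> (c, (x, x))] --> s x j.
  by apply: sj; exact: (cvg_comp _ _ cvg_snd cvg_fst).
have s2 : s p.2.2 j @[p --> (c, (x, x))] --> s x j.
  by apply: sj; exact: (cvg_comp _ _ cvg_snd cvg_snd).
exact: (cvg_comp _ _ (cvg_pair s1 s2) slc).
Qed.

Let L_continuous : continuous L.
Proof.
have LE z : L z = diag_mx (loss_grad (lsubmx z) (bias z)) *m row_mx 1%:M 0.
  by rewrite mul_mx_row mulmx1 mulmx0.
move=> x; rewrite /continuous_at LE; under eq_cvg do rewrite LE.
apply: (@cvg_mulmx _ _ (nbhs x)); last exact: cvg_cst.
apply: (@cvg_diag_mx _ _ (nbhs x)); apply: (@cvg_mx _ _ (nbhs x)) => i j; rewrite mxE.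
under eq_cvg do rewrite mxE.
apply: (@cvgMl_tmp _ _ (nbhs x)).
exact: (cvg_comp _ _ (s_continuous (i:=j) (x:=x)) (@dl_continuous _)).
Qed.

Lemma G_eq0 c x : G c x = 0 <-> stationary c (lsubmx x) (bias x).
Proof.
rewrite /G -[X in _ = X]row_mx0; split=> [/eq_row_mx[]//|[-> ->]//].
Qed.

(** Stationary points are followed over a full neighbourhood of [c], so derivatives make sense even
    on the boundary of the orthant; the sign of [c'] enters only when stationary points are turned
    into solutions. *)
Lemma kkt_solution_map c a b : (forall i, 0 <= c ord0 i) ->
  stationary c a b -> loss_curv c a b != 0 ->
  let v := loss_curv c a b in
  kkt_matrix K v \in unitmx /\ exists2 f : 'rV[R]_n -> 'rV[R]_(n + 1), f c = row_mx a b%:M &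
  [/\ \forall c' \near c,
        stationary c' (lsubmx (f c')) (bias (f c')) /\
        loss_curv c' (lsubmx (f c')) (bias (f c')) != 0,
      \forall c' \near c, differentiable f c',
      \forall c' \near c, {for c', continuous (fun d => 'J f d)} &
      ('J f c)^T = - (invmx (kkt_matrix K v) *m
                      col_mx (diag_mx (loss_grad a b)) (0 : 'M[R]_(1, n)))].
Proof.
move=> c0 st vn0 v; pose x0 : 'rV[R]_(n + 1) := row_mx a b%:M.
have ax0 : lsubmx x0 = a by rewrite row_mxKl.
have bx0 : bias x0 = b by rewrite /bias row_mxEr mxE eqxx.
have uv : kkt_matrix K v \in unitmx.
  apply: kkt_matrix_unit => // i; rewrite mxE mulr_ge0//.
  exact: nondecreasing_derive1_ge0.
split=> //.
have N0 : N (c, (x0, x0)) = (kkt_matrix K v)^T by rewrite N_diag ax0 bx0.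
have [||f fc fP] := @implicit_function _ _ _ G N L GE N_continuous L_continuous c x0.
- by apply/G_eq0; rewrite ax0 bx0.
- by rewrite N0 unitmx_tr.
exists f => //; split.
- apply: (filterS _ fP) => c' [Gc' Nu _ _ _].
  split; first exact: (G_eq0 c' (f c')).1 Gc'.
  apply: contraTneq Nu => v0.
  by rewrite N_diag v0 unitmx_tr kkt_matrix0_unit.
- by apply: (filterS _ fP) => c' [_ _ df _ _]; exact: df.
- by apply: (filterS _ fP) => c' [_ _ _ _ cJ]; exact: cJ.
have [_ _ _ -> _] := nbhs_singleton fP.
rewrite fc N0 /L ax0 bx0 linearN /= trmx_mul trmx_inv trmxK tr_row_mx trmx0.
by rewrite tr_diag_mx.
Qed.

End kkt.

Unset Implicit Arguments.

Theorem theorem5 (R : realType) (n : nat) (y : 'I_n -> R) (K : 'M[R]_n)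
  (l : R -> R) (c : 'rV[R]_n) (a : 'rV[R]_n) (b : R) :
  (forall i, y i = 1 \/ y i = -1) ->
  K^T = K ->
  (forall x : 'rV[R]_n, x != 0 -> 0 < (x *m K *m x^T) ord0 ord0) ->
  convex_fun l -> C2 l ->
  (forall i, 0 <= c ord0 i) ->
  is_solution K y l c a b ->
  let u := \row_i (y i * derive1 l (y i * margin K a b i)) in
  let v := \row_i (c ord0 i * derive1 (derive1 l) (y i * margin K a b i)) in
  v != 0 ->
  (* uniqueness of the solution at c *)
  (forall a' b', is_solution K y l c a' b' -> a' = a /\ b' = b) /\
  (* a C^1 solution map near c *)
  exists (A : 'rV[R]_n -> 'rV[R]_n) (B : 'rV[R]_n -> R),
    let Phi := fun c' => row_mx (A c') (B c')%:M : 'rV[R]_(n + 1) in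
    A c = a /\ B c = b /\
    (\forall c' \near c, (forall i, 0 <= (c' : 'rV[R]_n) ord0 i) ->
        is_solution K y l c' (A c') (B c') /\
        forall a' b', is_solution K y l c' a' b' -> a' = A c' /\ b' = B c') /\
    (\forall c' \near c, differentiable Phi c') /\
    (\forall c' \near c, {for c', continuous (fun z => 'J Phi z)}) /\
    kkt_matrix K v \in unitmx /\
    ('J Phi c)^T = - (invmx (kkt_matrix K v) *m col_mx (diag_mx u) (0 : 'M[R]_(1, n))).
Proof.
move=> y1 Ks Kp lc lC2 c0 sol u v v0.
have st := solution_stationary Ks Kp lc lC2 c0 sol.
have uniq := solution_unique y1 Ks Kp lc lC2.
split=> [a' b' sol'|]; first exact: uniq c0 v0 sol sol'.
have [uv [f fc [fsol fd fJ Jc]]] := kkt_solution_map y1 Ks Kp lc lC2 c0 st v0.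
exists (fun c' => lsubmx (f c')), (fun c' => bias (f c')) => Phi.
have -> : Phi = f by apply/funext => c'; exact: row_mx_bias.
split; first by rewrite fc row_mxKl.
split; first by rewrite fc /bias row_mxEr mxE eqxx.
split=> //.
(* The nonzero curvature at [c'] makes the uniqueness argument available there as well. *)
apply: filterS fsol => c' [st' v'0] c'0.
have sol' := stationary_solution Ks Kp lc lC2 c'0 st'.
by split => // a' b'; exact: uniq c'0 v'0 sol'.
Qed.
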